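(* For each integer $k\ge 0$ there exists a subset $K\subset\mathbb{R}^2$ such that $K$ is $r$ times differentiably basic for every integer $r$ with $0\le r\le k$, but $K$ is not $r$ times differentiably basic for any integer $r>k$.
   Context: Let $r\ge 0$ be an integer, $n\in\{1,2\}$ and $K\subset\mathbb{R}^n$. Write $|z,z_0|$ for the Euclidean distance between $z$ and $z_0$. A function $\alpha:\mathbb{R}^n\to\mathbb{R}$ is infinitesimal if for each $\varepsilon>0$ there exists $\delta>0$ such that $|\alpha(w)|<\varepsilon$ for each $w\in\mathbb{R}^n$ with Euclidean norm less than $\delta$ (in particular $\alpha(0)=0$). A function $f:K\to\mathbb{R}$ is called $r$ times differentiable if for each point $z_0\in K$ there exist a real polynomial $\overline f$ in $n$ variables of degree at most $r$ and an infinitesimal function $\alpha:\mathbb{R}^n\to\mathbb{R}$ such that $$f(z)=\overline f(z-z_0)+\alpha(z-z_0)\,|z,z_0|^r\quad\text{for each } z\in K,$$ where for $r=0$ the factor $|z,z_0|^0$ is understood to be $1$. (This pointwise definition differs from the generally accepted one; $0$ times differentiable means continuous, and $1$ time differentiable means differentiable.) A subset $K\subset\mathbb{R}^2$ is called $r$ times differentiably basic if for each $r$ times differentiable function $f:K\to\mathbb{R}$ there exist $r$ times differentiable functions $g:\mathbb{R}\to\mathbb{R}$ and $h:\mathbb{R}\to\mathbb{R}$ such that $f(x,y)=g(x)+h(y)$ for each point $(x,y)\in K$. *)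

(* Defs.v *)
From HB Require Import structures.
From mathcomp Require Import all_boot all_order all_algebra.
From mathcomp Require Import classical_sets reals.
From mathcomp Require Import mpoly.

Set Implicit Arguments.
Unset Strict Implicit.
Unset Printing Implicit Defensive.

Import Order.TTheory GRing.Theory Num.Theory.

Local Open Scope ring_scope.

Definition enorm (R : realType) (n : nat) (v : 'rV[R]_n) : R :=
  Num.sqrt (\sum_(i < n) v 0 i ^+ 2).

Definition infinitesimal (R : realType) (n : nat) (a : 'rV[R]_n -> R) : Prop :=
  forall e : R, 0 < e ->
    exists2 d : R, 0 < d & forall w : 'rV[R]_n, enorm w < d -> `|a w| < e.

(* A function on K is represented by a total function of which only the values
   on K matter. The degree bound reads [msize p <= r.+1] because [msize] is one
   more than the total degree; the zero polynomial is allowed. For r = 0 the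
   factor [enorm _ ^+ 0] is 1, also at z = z0. *)
Definition times_differentiable (R : realType) (n r : nat)
    (K : set 'rV[R]_n) (f : 'rV[R]_n -> R) : Prop :=
  forall z0 : 'rV[R]_n, K z0 ->
    exists (p : {mpoly R[n]}) (a : 'rV[R]_n -> R),
      [/\ (msize p <= r.+1)%N, infinitesimal a
        & forall z : 'rV[R]_n, K z ->
            f z = p.@[(z - z0) 0] + a (z - z0) * enorm (z - z0) ^+ r].

Definition times_differentiable1 (R : realType) (r : nat) (g : R -> R) : Prop :=
  times_differentiable r [set: 'rV[R]_1] (fun w : 'rV[R]_1 => g (w 0 0)).

Definition differentiably_basic (R : realType) (r : nat) (K : set 'rV[R]_2)
    : Prop :=
  forall f : 'rV[R]_2 -> R, times_differentiable r K f ->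
    exists g h : R -> R,
      [/\ times_differentiable1 r g, times_differentiable1 r h
        & forall z : 'rV[R]_2, K z -> f z = g (z 0 0) + h (z 0 1)].

(* Main.v *)
Require Import Defs.
From mathcomp Require Import all_boot all_order all_algebra.
From mathcomp Require Import classical_sets reals.
From mathcomp Require Import mpoly ring lra.

Set Implicit Arguments.
Unset Strict Implicit.
Unset Printing Implicit Defensive.

Import Order.TTheory GRing.Theory Num.Theory.

Local Open Scope ring_scope.

(** [K] is the union of the half-curves y = x^k (x >= 0) and y = -x^k (x <= 0).
    Both are parametrized by x, so for f on [K] it is enough to choose h
    well: g is then forced, and away from x = 0 it inherits the regularity of f
    because each half-curve is polynomial. At x = 0 the only obstruction comes
    from the mixed monomials x^i y^j of the Taylor polynomial of f, which are
    O(x^(k+1)) on [K], negligible exactly when r <= k.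

    For r > k take f = xy, which equals +-x^(k+1) on the half-curves. The
    expansions of g(x) and of h(x^k) and h(-x^k) at x = 0 would have
    coefficients of x^(k+1) that add up to 1 on one half-curve and to -1 on the other. Those of
    g agree, and so do those of h: for k >= 2 because k does not divide k + 1,
    for k = 1 because the coefficient of x^2 in h(+-x) does not depend on the
    sign, and for k = 0 because h(+-1) is constant. *)

(** * Little-o estimates at 0 along a subset of the line *)

(** The predicate [D] allows one-sided estimates, one per half-curve. The bound is a product rather
    than a quotient, so it also makes sense at [w = 0], where it forces [u 0 = 0] as soon as [D 0]
    holds, even for [r = 0]. *)
Definition littleo (R : realType) (D : pred R) (r : nat) (u : R -> R) : Prop :=
  forall e : R, 0 < e -> exists2 d : R, 0 < d &
    forall w : R, D w -> `|w| < d -> `|u w| <= e * `|w| ^+ r.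

Lemma horner_bounded (R : realType) (p : {poly R}) :
  exists2 C : R, 0 < C & forall t, `|t| <= 1 -> `|p.[t]| <= C.
Proof.
exists (1 + \sum_(i < size p) `|p`_i|); first by rewrite ltr_wpDr ?sumr_ge0.
move=> t t1; rewrite horner_coef (le_trans (ler_norm_sum _ _ _)) //.
rewrite (le_trans (ler_sum _ (G := fun i : 'I__ => `|p`_i|) _)) ?lerDr //.
by move=> i _; rewrite normrM normrX ler_piMr // exprn_ile1.
Qed.

Lemma littleoD (R : realType) (D : pred R) r (u v : R -> R) :
  littleo D r u -> littleo D r v -> littleo D r (fun w => u w + v w).
Proof.
move=> ou ov e e0; have e20 : 0 < e / 2 by rewrite divr_gt0.
have [d d0 du] := ou _ e20; have [d' d'0 dv] := ov _ e20.
exists (Num.min d d') => [|w Dw]; first by rewrite lt_min d0.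
rewrite lt_min => /andP[wd wd'].
rewrite (le_trans (ler_normD _ _)) // [e]splitr mulrDl.
by rewrite lerD ?du ?dv.
Qed.

Lemma eq_littleo (R : realType) (D : pred R) r (u v : R -> R) :
  (forall w, D w -> u w = v w) -> littleo D r u -> littleo D r v.
Proof.
move=> uv ou e /ou[d d0 du]; exists d => // w Dw wd.
by rewrite -uv // du.
Qed.

Lemma sub_littleo (R : realType) (D D' : pred R) r (u : R -> R) :
  subpred D' D -> littleo D r u -> littleo D' r u.
Proof.
by move=> DD ou e /ou[d d0 du]; exists d => // w /DD Dw; apply: du.
Qed.

Lemma littleo_near (R : realType) (D D' : pred R) r (u : R -> R) d0 :
    0 < d0 -> (forall w, D' w -> `|w| < d0 -> D w) ->
  littleo D r u -> littleo D' r u.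
Proof.
move=> d0_gt0 DD ou e /ou[d d_gt0 du].
exists (Num.min d d0) => [|w D'w]; first by rewrite lt_min d_gt0.
by rewrite lt_min => /andP[wd wd0]; apply: du (DD _ D'w wd0) wd.
Qed.

Lemma littleoN (R : realType) (D : pred R) r (u : R -> R) :
  littleo D r u -> littleo D r (fun w => - u w).
Proof.
by move=> ou e /ou[d d0 du]; exists d => // w Dw wd; rewrite normrN du.
Qed.

Lemma littleo_cover (R : realType) (D1 D2 : pred R) r (u : R -> R) :
    (forall w, D1 w || D2 w) -> littleo D1 r u -> littleo D2 r u ->
  littleo predT r u.
Proof.
move=> D12 ou1 ou2 e e0; have [d1 d10 du1] := ou1 _ e0.
have [d2 d20 du2] := ou2 _ e0.
exists (Num.min d1 d2) => [|w _]; first by rewrite lt_min d10.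
rewrite lt_min => /andP[wd1 wd2].
by case/orP: (D12 w) => [/du1|/du2]; apply.
Qed.

Lemma leq_littleo (R : realType) (D : pred R) r r' (u : R -> R) :
  (r' <= r)%N -> littleo D r u -> littleo D r' u.
Proof.
move=> rr ou e e0; have [d d0 du] := ou _ e0.
exists (Num.min d 1) => [|w Dw]; first by rewrite lt_min d0 ltr01.
rewrite lt_min => /andP[wd w1]; apply: le_trans (du _ Dw wd) _.
by rewrite ler_pM2l // ler_wiXn2l // ltW.
Qed.

Lemma littleo_eq0 (R : realType) (D : pred R) r (u : R -> R) :
  D 0 -> littleo D r u -> u 0 = 0.
Proof.
move=> D0 ou; apply/eqP; rewrite -normr_eq0 -[_ == _]negbK.
apply/negP => u0; have {u0} u0 : 0 < `|u 0| by rewrite lt_def u0 normr_ge0.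
have [d d0 /(_ 0 D0)] := ou (`|u 0| / 2) (divr_gt0 u0 (ltr0Sn _ _)).
rewrite normr0 d0 expr0n => /(_ isT).
by case: (r) => [|?] /=; lra.
Qed.

Lemma littleo_horner (R : realType) (D : pred R) r (u : R -> R) (p : {poly R}) :
  (forall w, D w -> u w = w ^+ r.+1 * p.[w]) -> littleo D r u.
Proof.
move=> uE e e0; have [C C0 Cp] := horner_bounded p.
exists (Num.min 1 (e / C)) => [|w Dw].
  by rewrite lt_min ltr01 divr_gt0.
rewrite lt_min => /andP[w1 wC]; rewrite uE // normrM normrX exprS mulrAC.
rewrite ler_wpM2r ?exprn_ge0 // -(divfK (lt0r_neq0 C0) e) ler_pM //.
  exact: ltW.
by rewrite Cp // ltW.
Qed.


(** * Uniqueness of the coefficients of a one-sided expansion *)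

Lemma littleo_coef0 (R : realType) (b : bool) (m : nat) (p : {poly R}) :
  littleo (fun w => 0 < (-1) ^+ b * w) m (fun w => p.[w]) -> p`_0 = 0.
Proof.
move=> op; set c := p`_0.
have [q pE] : exists q, p = q * 'X + c%:P.
  have /factor_theorem[q] : root (p - c%:P) 0.
    by rewrite /root hornerD hornerN hornerC horner_coef0 subrr.
  by rewrite subr0 => pE; exists q; rewrite -pE subrK.
apply/eqP; rewrite -normr_eq0 -[_ == _]negbK; apply/negP => c0.
have {}c0 : 0 < `|c| by rewrite lt_def c0 normr_ge0.
have [C C0 Cq] := horner_bounded q.
have [d d0 dp] := op (`|c| / 4) ltac:(by rewrite divr_gt0).
(* At distance [t] from 0 on the side given by [b], the bound [d] makes the estimate on [p]
   available, 1 bounds both the power of [w] and [q], and the third bound keeps the value of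
   [q * 'X] below a quarter of [|c|]. Then [|c|] would be less than its own half. *)
pose t := Num.min d (Num.min 1 (`|c| / (4 * C))) / 2.
have t0 : 0 < t.
  by rewrite divr_gt0 // !lt_min d0 ltr01 divr_gt0 // mulr_gt0.
have [td t1 tC] : [/\ t < d, t < 1 & t < `|c| / (4 * C)].
  have: t < Num.min d (Num.min 1 (`|c| / (4 * C))).
    by move: t0; rewrite /t; lra.
  by rewrite !lt_min => /and3P[].
pose w := (-1) ^+ b * t.
have wt : `|w| = t by rewrite normrM normr_sign mul1r gtr0_norm.
have /dp : 0 < (-1) ^+ b * w by rewrite mulrA -expr2 sqrr_sign mul1r.
rewrite wt => /(_ td) pw.
have {}pw : `|p.[w]| <= `|c| / 4.
  apply: le_trans pw _; rewrite ler_piMr ?divr_ge0 //.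
  by rewrite exprn_ile1 // ltW.
have qw : `|q.[w] * w| < `|c| / 4.
  rewrite normrM wt; apply: le_lt_trans (_ : C * t < _).
    by rewrite ler_pM2r // Cq // wt ltW.
  by move: tC; rewrite invfM mulrA ltr_pdivlMr // mulrC.
have := ler_normB p.[w] (q.[w] * w).
rewrite {1}pE hornerD hornerM hornerX hornerC addrAC subrr add0r; lra.
Qed.

(* The domain omits 0 so that the induction can divide by [w]. *)
Lemma littleo_coef (R : realType) (b : bool) (m : nat) (p : {poly R}) :
  littleo (fun w => 0 < (-1) ^+ b * w) m (fun w => p.[w]) ->
  forall i, (i <= m)%N -> p`_i = 0.
Proof.
elim: m p => [|m IHm] p op; have p0 := littleo_coef0 op; first by case.
have [q pE] : exists q, p = q * 'X.
  have /factor_theorem[q ->] : root p 0 by rewrite /root horner_coef0 p0.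
  by exists q; rewrite subr0.
case=> [//|i] lim; rewrite pE coefMX /= (IHm q) // => e /op[d d0 dp].
exists d => // w bw wd; have w0 : 0 < `|w|.
  by rewrite normr_gt0; apply: contraTneq bw => ->; rewrite mulr0 ltxx.
have := dp w bw wd; rewrite pE hornerM hornerX normrM exprSr mulrA.
by rewrite ler_pM2r.
Qed.

(** * Coordinates and polynomials in the plane *)

Definition pt (R : realType) (x y : R) : 'rV[R]_2 :=
  \row_i (if i == 0 then x else y).

Lemma pt0 (R : realType) (x y : R) : pt x y 0 0 = x.
Proof. by rewrite mxE. Qed.

Lemma pt1 (R : realType) (x y : R) : pt x y 0 1 = y.
Proof. by rewrite mxE. Qed.

Lemma ptE (R : realType) (z : 'rV[R]_2) : z = pt (z 0 0) (z 0 1).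
Proof.
apply/rowP => i; rewrite mxE; case: eqP => [->//|/eqP i0].
by congr (z 0 _); apply/val_inj; case: i i0 => [[|[|]]].
Qed.

Lemma ptB (R : realType) (x y x' y' : R) :
  pt x y - pt x' y' = pt (x - x') (y - y').
Proof. by rewrite [LHS]ptE !mxE. Qed.

Lemma enorm_row1 (R : realType) (w : 'rV[R]_1) : enorm w = `|w 0 0|.
Proof. by rewrite /enorm big_ord1 sqrtr_sqr. Qed.

Lemma enorm_ge0 (R : realType) n (w : 'rV[R]_n) : 0 <= enorm w.
Proof. exact: sqrtr_ge0. Qed.

Lemma enorm_pt_le (R : realType) (x y : R) : enorm (pt x y) <= `|x| + `|y|.
Proof.
rewrite /enorm big_ord_recl big_ord1 !mxE /=.
rewrite -[leRHS]ger0_norm ?addr_ge0 // -sqrtr_sqr ler_wsqrtr //.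
rewrite -[x ^+ 2]real_normK ?num_real // -[y ^+ 2]real_normK ?num_real //.
by rewrite sqrrD lerD2r lerDl mulrn_wge0 // mulr_ge0.
Qed.

Lemma meval2E (R : realType) (p : {mpoly R[2]}) (z : 'rV[R]_2) :
  p.@[z 0] = \sum_(m <- msupp p) p@_m * (z 0 0 ^+ m 0 * z 0 1 ^+ m 1).
Proof.
rewrite mevalE; apply: eq_bigr => m _; rewrite big_ord_recl big_ord1.
by congr (_ * (_ * z 0 _ ^+ m _)); apply/val_inj.
Qed.

Definition msubst2 (R : realType) (p : {mpoly R[2]}) (A B : {poly R}) : {poly R} :=
  \sum_(m <- msupp p) p@_m *: (A ^+ m 0 * B ^+ m 1).

Lemma horner_msubst2 (R : realType) (p : {mpoly R[2]}) (A B : {poly R}) t :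
  (msubst2 p A B).[t] = p.@[pt A.[t] B.[t] 0].
Proof.
rewrite meval2E horner_sum; apply: eq_bigr => m _.
by rewrite pt0 pt1 hornerZ hornerM !horner_exp.
Qed.

(** * Peano expansions in one variable *)

(** The degree of [p] is left free so that compositions of polynomials can serve as expansions;
    terms of degree above [r] are negligible and get truncated in the equivalence with
    [times_differentiable1]. *)
Definition peano (R : realType) (r : nat) (g : R -> R) (x0 : R) : Prop :=
  exists p : {poly R}, littleo predT r (fun w => g (x0 + w) - p.[w]).

Lemma times_differentiable1P (R : realType) (r : nat) (g : R -> R) :
  times_differentiable1 r g <-> forall x, peano r g x.
Proof.
split=> [tdg x|pg z0 _].
  have [p [a [_ a_inf gE]]] := tdg (const_mx x) I.
  exists (\sum_(m <- msupp p) p@_m *: 'X ^+ m 0) => e /a_inf[d d0 da].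
  exists d => // w _ wd; have := gE (const_mx (x + w)) I.
  have -> : const_mx (x + w) - const_mx x = const_mx w :> 'rV[R]_1.
    by apply/rowP => i; rewrite !mxE addrC addKr.
  rewrite !enorm_row1 mevalE !mxE => ->.
  under eq_bigr do rewrite big_ord1 mxE.
  rewrite horner_sum; under [X in _ - X]eq_bigr do rewrite hornerZ hornerXn.
  rewrite addrC addKr normrM normrX normr_id ler_wpM2r ?exprn_ge0 //.
  by rewrite ltW // da // enorm_row1 mxE.
have [p op] := pg (z0 0 0).
pose u w := g (z0 0 0 + w) - (\sum_(i < r.+1) p`_i *: 'X^i).[w].
have ou : littleo predT r u.
  have oq : littleo predT r (fun w => (p - \sum_(i < r.+1) p`_i *: 'X^i).[w]).
    (* The terms removed by the truncation sum to [q * 'X^r.+1]. *)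
    pose q := \poly_(i < size p - r.+1) p`_(i + r.+1).
    apply: (@littleo_horner _ _ _ _ q) => w _; rewrite mulrC -hornerXn -hornerM.
    congr _.[_]; apply/polyP => i; rewrite coefB coefMXn coef_sum.
    under eq_bigr do rewrite coefZ coefXn.
    case: ltnP => ir.
      rewrite (bigD1 (Ordinal ir)) //= eqxx mulr1 big1 ?addr0 ?subrr // => j.
      by rewrite -val_eqE eq_sym /= => /negPf->; rewrite mulr0.
    rewrite big1 ?subr0 => [|j _].
      rewrite coef_poly subnK //; case: ltnP => // ip.
      by rewrite nth_default // -(subnKC ir) -leq_subLR.
    by rewrite gtn_eqF ?mulr0 // (leq_trans _ ir).
  apply: eq_littleo (littleoD op oq) => w _.
  by rewrite hornerD hornerN /u; ring.
exists (\sum_(i < r.+1) p`_i *: 'X_[U_(0) *+ i]).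
(* At [w = 0] the quotient is 0, as an infinitesimal requires: for [r > 0] because the inverse of 0
   is 0, for [r = 0] because [u 0 = 0]. *)
exists (fun w => u (w 0 0) / `|w 0 0| ^+ r); split=> [|e e0|z _].
- rewrite (leq_trans (msize_sum _ _ _)) //; apply/bigmax_leqP => i _.
  rewrite (leq_trans (msizeZ_le _ _)) // msizeX mdegMn mdeg1 mul1n.
  by rewrite ltn_ord.
- have [d d0 du] := ou (e / 2) ltac:(by rewrite divr_gt0).
  exists d => // w; rewrite enorm_row1 => wd.
  rewrite normrM normfV normrX normr_id; have := du _ isT wd.
  have [w0|w0] := eqVneq (`|w 0 0| ^+ r) 0.
    by rewrite w0 invr0 !mulr0.
  have {}w0 : 0 < `|w 0 0| ^+ r by rewrite lt_def w0 exprn_ge0.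
  by rewrite -ler_pdivrMr // => /le_lt_trans->//; lra.
have -> : g (z 0 0) = u ((z - z0) 0 0) + (\sum_(i < r.+1) p`_i *: 'X^i).[(z - z0) 0 0].
  by rewrite /u /= subrK !mxE; congr g; ring.
rewrite addrC enorm_row1; congr (_ + _).
  rewrite raddf_sum horner_sum; apply: eq_bigr => i _ /=.
  by rewrite mevalZ hornerZ hornerXn mevalX big_ord1 mulmnE mnmE eqxx mul1n.
have [w0|w0] := eqVneq (`|(z - z0) 0 0| ^+ r) 0; last by rewrite divfK.
rewrite w0 mulr0; move: w0 => /eqP; rewrite expf_eq0 normr_eq0 => /andP[_ /eqP->].
exact: (littleo_eq0 _ ou).
Qed.

(** * The curve and its basicness for [r <= k] *)

(** The sign [(-1) ^+ b] selects the half-curve. Both halves include [x = 0]: they meet at the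
    origin if [k > 0], and end at the distinct points (0, 1) and (0, -1) if [k = 0]. *)
Definition curve (R : realType) (k : nat) : set 'rV[R]_2 :=
  fun z => exists b : bool,
    0 <= (-1) ^+ b * z 0 0 /\ z 0 1 = (-1) ^+ b * z 0 0 ^+ k.

Lemma curve_pt (R : realType) (k : nat) (b : bool) (x : R) :
  0 <= (-1) ^+ b * x -> curve k (pt x ((-1) ^+ b * x ^+ k)).
Proof. by move=> bx; exists b; rewrite pt0 pt1. Qed.

(** The displacement along a half-curve is [(w, B.[w])] with [B] vanishing at 0, so its norm is at
    most [(1 + C) * |w|] for small [w]. A remainder that is small relative to the norm is thus small
    relative to [|w|]. *)
Lemma curve_expansion (R : realType) (r k : nat) (f : 'rV[R]_2 -> R) (b : bool)
    (x0 : R) (p : {mpoly R[2]}) (a : 'rV[R]_2 -> R) :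
  let s := (-1) ^+ b in let z0 := pt x0 (s * x0 ^+ k) in
    infinitesimal a ->
    (forall z, curve k z ->
      f z = p.@[(z - z0) 0] + a (z - z0) * enorm (z - z0) ^+ r) ->
  littleo (fun w => 0 <= s * (x0 + w)) r
    (fun w => f (pt (x0 + w) (s * (x0 + w) ^+ k)) -
      (msubst2 p 'X (s *: (('X + x0%:P) ^+ k - (x0 ^+ k)%:P))).[w]).
Proof.
move=> s z0 a_inf fE; set B := s *: _.
have BE w : B.[w] = s * (x0 + w) ^+ k - s * x0 ^+ k.
  by rewrite !hornerE mulrBr [w + _]addrC.
have [q Bq] : exists q, B = q * 'X.
  have /factor_theorem[q ->] : root B 0 by rewrite /root BE addr0 subrr.
  by exists q; rewrite subr0.
have [C C0 Cq] := horner_bounded q.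
have C1 : 0 < 1 + C by rewrite addr_gt0.
move=> e e0.
have [d d0 da] := a_inf (e / (1 + C) ^+ r) ltac:(by rewrite divr_gt0 // exprn_gt0).
exists (Num.min 1 (d / (1 + C))) => [|w sw]; first by rewrite lt_min ltr01 divr_gt0.
rewrite lt_min => /andP[w1 wd].
rewrite fE; last exact: curve_pt.
rewrite horner_msubst2 hornerX BE /z0 ptB [x0 + w - x0]addrC addKr -BE addrC addKr.
have wC : enorm (pt w B.[w]) <= (1 + C) * `|w|.
  rewrite (le_trans (enorm_pt_le _ _)) // mulrDl mul1r lerD2l.
  by rewrite Bq hornerM hornerX normrM ler_wpM2r // Cq // ltW.
have /da/ltW aw : enorm (pt w B.[w]) < d.
  by rewrite (le_lt_trans wC) // mulrC -ltr_pdivlMr.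
rewrite normrM normrX (ger0_norm (enorm_ge0 _)).
have -> : e * `|w| ^+ r = e / (1 + C) ^+ r * ((1 + C) * `|w|) ^+ r.
  by rewrite exprMn mulrA divfK // lt0r_neq0 // exprn_gt0.
by rewrite ler_pM ?exprn_ge0 ?enorm_ge0 // lerXn2r ?nnegrE ?enorm_ge0 // mulr_ge0 // ltW.
Qed.

(* For [k > 0], [h] collects the pure powers of [y] in the Taylor polynomial [p]
   of [f] at the origin and [A] its pure powers of [x]; a mixed monomial is
   [O(w ^ (k + 1))] on the curve. For [k = 0] the curve has two points above
   [x = 0], and [h] interpolates [f] at them. *)
Lemma curve_splitting (R : realType) (r k : nat) (f : 'rV[R]_2 -> R) :
    (r <= k)%N -> times_differentiable r (curve k) f ->
  exists A h : {poly R}, forall b : bool, let s := (-1) ^+ b in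
    littleo (fun w => 0 <= s * w) r
      (fun w => f (pt w (s * w ^+ k)) - h.[s * w ^+ k] - A.[w]).
Proof.
have s0 b : 0 <= (-1) ^+ b * 0 :> R by rewrite mulr0.
have opE (b : bool) (u v : R -> R) : littleo (fun w => 0 <= (-1) ^+ b * (0 + w)) r u ->
    (forall w, u w = v w) -> littleo (fun w => 0 <= (-1) ^+ b * w) r v.
  move=> ou uv; apply: eq_littleo (sub_littleo _ ou) => // w.
  by rewrite add0r.
case: k => [|k] rk tdf.
  move: rk; rewrite leqn0 => /eqP r0; rewrite r0 in tdf opE *.
  pose c (b : bool) := f (pt 0 ((-1) ^+ b)).
  pose h := ((c false + c true) / 2)%:P + ((c false - c true) / 2) *: 'X.
  exists 0, h => b s.
  have hE : h.[s] = f (pt 0 s).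
    rewrite /h !hornerE /c /s; case: (b) => /=; rewrite ?expr0 ?expr1.
    - by have avgB (u v : R) : (u + v) / 2 + (u - v) / 2 * -1 = v by lra.
    - by have avgD (u v : R) : (u + v) / 2 + (u - v) / 2 * 1 = u by lra.
  have := curve_pt 0 (s0 b); rewrite expr0 mulr1 => /tdf[p [a [_ a_inf fE]]].
  have := @curve_expansion _ 0 0 f b 0 p a a_inf.
  rewrite expr0 mulr1 => /(_ fE); set Q := msubst2 _ _ _ => oQ.
  have Q0 : f (pt 0 s) = Q.[0].
    apply/eqP; rewrite -subr_eq0; apply/eqP.
    have D0 : 0 <= s * (0 + 0) by rewrite addr0 mulr0.
    by have := littleo_eq0 D0 oQ; rewrite /= addr0.
  have [q qE] : exists q, Q - Q.[0]%:P = q * 'X.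
    have /factor_theorem[q ->] : root (Q - Q.[0]%:P) 0.
      by rewrite /root !hornerE subrr.
    by exists q; rewrite subr0.
  have oq : littleo (fun w => 0 <= s * (0 + w)) 0 (fun w => (Q - Q.[0]%:P).[w]).
    by apply: (@littleo_horner _ _ _ _ q) => w _; rewrite qE !hornerE mulrC.
  apply: opE (littleoD oQ oq) _ => w.
  by rewrite add0r -/s hE Q0 hornerD hornerN hornerC horner0; ring.
have := curve_pt k.+1 (s0 false).
rewrite expr0n mulr0 => /tdf[p [a [_ a_inf fE]]].
(* The constant term goes to [h], so [A] keeps only positive powers of [x]. *)
exists (\sum_(m <- msupp p) (p@_m *+ ((m 0 != 0%N) && (m 1 == 0%N))) *: 'X^(m 0)).
exists (\sum_(m <- msupp p) (p@_m *+ (m 0 == 0%N)) *: 'X^(m 1)) => b s.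
have := @curve_expansion _ r k.+1 f b 0 p a a_inf.
rewrite expr0n mulr0 => /(_ fE) oQ.
set Q := msubst2 _ _ _ in oQ.
(* With [y = s * w ^+ k.+1], each mixed monomial contains at least one factor [w] and one factor
   [y], hence [w ^+ k.+2]; [E] is what remains after extracting it. *)
pose E := \sum_(m <- msupp p) (p@_m *+ ((m 0 != 0%N) && (m 1 != 0%N))) *:
  ('X^((m 0).-1) * (s *: (s *: 'X^(k.+1)) ^+ (m 1).-1)).
have oE : littleo (fun w => 0 <= s * (0 + w)) r (fun w => w ^+ k.+2 * E.[w]).
  by apply: leq_littleo rk _; apply: (@littleo_horner _ _ _ _ E).
apply: opE (littleoD oQ oE) _ => w.
rewrite add0r -!addrA; congr (_ + _).
suff -> : Q.[w] = w ^+ k.+2 * E.[w] +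
    ((\sum_(m <- msupp p) (p@_m *+ (m 0 == 0%N)) *: 'X^(m 1)).[s * w ^+ k.+1] +
    (\sum_(m <- msupp p) (p@_m *+ ((m 0 != 0%N) && (m 1 == 0%N))) *: 'X^(m 0)).[w]).
  by ring.
rewrite /Q /msubst2 !horner_sum mulr_sumr -!big_split; apply: eq_bigr => m _ /=.
rewrite !hornerE -/s /= subr0.
case: (m 0) => [|i]; case: (m 1) => [|j] /=.
all: rewrite ?mulr1n ?mulr0n ?expr0 ?exprS; ring.
Qed.

Lemma times_differentiable1_horner (R : realType) (r : nat) (h : {poly R}) :
  times_differentiable1 r (horner h).
Proof.
apply/times_differentiable1P => x; exists (h \Po ('X + x%:P)).
apply: (@littleo_horner _ _ _ _ 0) => w _.
by rewrite horner_comp !hornerE [w + x]addrC subrr.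
Qed.

Lemma curve_basic (R : realType) (r k : nat) :
  (r <= k)%N -> differentiably_basic r (@curve R k).
Proof.
move=> rk f tdf; have [A [h oA]] := curve_splitting rk tdf.
pose g (b : bool) x := f (pt x ((-1) ^+ b * x ^+ k)) - h.[(-1) ^+ b * x ^+ k].
have g0 b : g b 0 = A.[0].
  apply/eqP; rewrite -subr_eq0; apply/eqP.
  by apply: littleo_eq0 (oA b); rewrite mulr0.
(* At [x = 0] either branch may be used, since [g0] gives both the value [A.[0]]. *)
pose G x := g (x < 0) x.
have GE (b : bool) x : 0 <= (-1) ^+ b * x -> G x = g b x.
  have [->|x0] := eqVneq x 0; first by rewrite /G !g0.
  rewrite /G; case: b; rewrite ?expr0 ?expr1 ?mul1r ?mulN1r.
    by rewrite oppr_ge0 lt_neqAle x0 => ->.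
  by rewrite leNgt => /negPf ->.
exists G, (horner h); split; last 1 first.
- move=> z [b [bz z1]]; rewrite (GE b _ bz) /g -z1 subrK.
  by rewrite -ptE.
- apply/times_differentiable1P => x; have [->|x0] := eqVneq x 0.
    (* The two one-sided expansions at 0 share the polynomial [A], so they glue to a two-sided
       one. *)
    exists A; have oG (b : bool) : littleo (fun w => 0 <= (-1) ^+ b * w) r
        (fun w => G (0 + w) - A.[w]).
      apply: eq_littleo (oA b) => w bw.
      by rewrite add0r (GE b).
    apply: littleo_cover (oG false) (oG true) => w.
    by rewrite expr0 expr1 mul1r mulN1r oppr_ge0 le_total.
  pose b := x < 0.
  (* A displacement shorter than [|x|] cannot change the sign, so near [x] only one half-curve
     matters. *)
  have bx (w : R) : `|w| < `|x| -> 0 <= (-1) ^+ b * (x + w).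
    move: x0; rewrite /b; case: ltrgt0P => // x0 _.
      by rewrite expr0 mul1r ltr_norml; lra.
    by rewrite expr1 mulN1r ltr_norml; lra.
  have bx0 : 0 <= (-1) ^+ b * x by rewrite -[x]addr0 bx // normr0 normr_gt0.
  have [p [a [_ a_inf fE]]] := tdf _ (curve_pt k bx0).
  have := curve_expansion a_inf fE; set Q := msubst2 _ _ _ => oQ.
  exists (Q - (h \Po ((-1) ^+ b *: ('X + x%:P) ^+ k))).
  suff oG : littleo (fun w => 0 <= (-1) ^+ b * (x + w)) r
      (fun w => G (x + w) - (Q - (h \Po ((-1) ^+ b *: ('X + x%:P) ^+ k))).[w]).
    have x_gt0 : 0 < `|x| by rewrite normr_gt0.
    by apply: littleo_near x_gt0 _ oG => w _; apply: bx.
  apply: eq_littleo oQ => w bw; rewrite (GE b _ bw) /g.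
  by rewrite hornerD hornerN horner_comp !hornerE [w + x]addrC; ring.
- exact: times_differentiable1_horner.
Qed.

(** * Failure of basicness for [r > k] *)

Lemma coord_le_enorm (R : realType) n (w : 'rV[R]_n) i : `|w 0 i| <= enorm w.
Proof.
rewrite -sqrtr_sqr ler_wsqrtr // (bigD1 i) //= lerDl sumr_ge0 // => j _.
exact: sqr_ge0.
Qed.

(** The expansion about [z0] is an exact polynomial of degree at most 2, which settles [r >= 2]. For
    [r = 1] the product of the two increments becomes the remainder; divided by the norm, it is at
    most the norm. *)
Lemma times_differentiable_xy (R : realType) (r : nat) (K : set 'rV[R]_2) :
  (0 < r)%N -> times_differentiable r K (fun z => z 0 0 * z 0 1).
Proof.
move=> r0 z0 _; pose x := z0 0 0; pose y := z0 0 1.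
pose q : {mpoly R[2]} := (x * y)%:MP + (y *: 'X_0 + x *: 'X_1).
have sq : (msize q <= 2)%N.
  rewrite (leq_trans (msizeD_le _ _)) // geq_max msizeC.
  rewrite (leq_trans (leq_b1 _)) //= (leq_trans (msizeD_le _ _)) // geq_max.
  by rewrite !(leq_trans (msizeZ_le _ _)) ?msizeX ?mdeg1.
have qE (z : 'rV[R]_2) : q.@[z 0] = x * y + (y * z 0 0 + x * z 0 1).
  by rewrite !mevalD mevalC !mevalZ !mevalXU.
have [->|r1] := eqVneq r 1%N.
  exists q, (fun w : 'rV_2 => w 0 0 * w 0 1 / enorm w); split => // [e e0|z _].
    exists e => // w we; rewrite normrM normfV (ger0_norm (enorm_ge0 w)).
    have [->|w0] := eqVneq (enorm w) 0; first by rewrite invr0 mulr0.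
    have E0 : 0 < enorm w by rewrite lt_def w0 enorm_ge0.
    rewrite ltr_pdivrMr // normrM; apply: le_lt_trans (_ : enorm w * enorm w < _).
      by rewrite ler_pM ?coord_le_enorm.
    by rewrite ltr_pM2r.
  have wE : (z - z0) 0 0 * (z - z0) 0 1 / enorm (z - z0) * enorm (z - z0) =
      (z - z0) 0 0 * (z - z0) 0 1.
    have [w0|w0] := eqVneq (enorm (z - z0)) 0; last by rewrite divfK.
    have := coord_le_enorm (z - z0) 0; rewrite w0 normr_le0 => /eqP ->.
    by rewrite !mul0r.
  by rewrite expr1 wE qE !mxE /x /y; ring.
exists (q + 'X_0 * 'X_1), (fun=> 0); split => [|e e0|z _].
- have r2 : (1 < r)%N by rewrite ltn_neqAle eq_sym r1.
  rewrite (leq_trans (msizeD_le _ _)) // geq_max (leq_trans sq (leqW r2)).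
  by rewrite -mpolyXD msizeX mdegD !mdeg1.
- by exists 1 => // w _; rewrite normr0.
- by rewrite mevalD mevalM !mevalXU qE mul0r addr0 !mxE /x /y; ring.
Qed.

Lemma curve_not_basic (R : realType) (r k : nat) :
  (k < r)%N -> ~ differentiably_basic r (@curve R k).
Proof.
move=> kr /(_ (fun z => z 0 0 * z 0 1))[].
  exact: times_differentiable_xy (leq_ltn_trans (leq0n k) kr).
move=> g [h [/times_differentiable1P tdg /times_differentiable1P tdh ghE]].
have [p op] := tdg 0.
have [q oq q01] : exists2 q : bool -> {poly R},
    forall b : bool, littleo (fun w => 0 < (-1) ^+ b * w) k.+1
      (fun w => h ((-1) ^+ b * w ^+ k) - (q b).[w])
    & (q false)`_k.+1 = (q true)`_k.+1.
  have [->|k0] := posnP k.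
    exists (fun b : bool => (h ((-1) ^+ b))%:P) => [b|]; last by rewrite !coefC.
    apply: (@littleo_horner _ _ _ _ 0) => w _.
    by rewrite expr0 mulr1 hornerC subrr horner0 mulr0.
  have [q oq] := tdh 0.
  pose qs (b : bool) := \poly_(i < size q) (q`_i * ((-1) ^+ b) ^+ i).
  have qsE b w : (qs b).[w] = q.[(-1) ^+ b * w].
    rewrite horner_poly horner_coef; apply: eq_bigr => i _.
    by rewrite exprMn mulrA.
  exists (fun b => qs b \Po 'X^k) => [b e e0|]; last first.
    (* Here [k] divides [k + 1] only if [k = 1]; then the coefficient has degree 2 and the sign
       enters squared. *)
    rewrite !coef_comp_poly_Xn // -addn1 dvdn_addr ?dvdnn // dvdn1.
    case: eqP => // ->; rewrite divn1 !coef_poly.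
    by rewrite !sqrr_sign.
  have [d d0 dq] := oq e e0; exists (Num.min 1 d) => [|w bw].
    by rewrite lt_min ltr01.
  rewrite lt_min => /andP[w1 wd].
  have wk : `|(-1) ^+ b * w ^+ k| = `|w| ^+ k.
    by rewrite normrM normr_sign mul1r normrX.
  have := dq ((-1) ^+ b * w ^+ k) isT; rewrite wk add0r horner_comp hornerXn qsE.
  have wkw : `|w| ^+ k <= `|w|.
    by rewrite -[leRHS]expr1 ler_wiXn2l // ltW.
  move=> /(_ (le_lt_trans wkw wd))/le_trans; apply.
  (* The error is of order [k * r], and [k * r >= r >= k + 1] since [k > 0]. *)
  rewrite ler_pM2l // -exprM ler_wiXn2l //; first exact: ltW.
  by rewrite (leq_trans kr) // leq_pmull.
have S0 (b : bool) : (p + q b - (-1) ^+ b *: 'X^(k.+1))`_k.+1 = 0.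
  apply: (@littleo_coef _ b k.+1) => //.
  have op' := leq_littleo kr (sub_littleo
     (D' := fun w => 0 < (-1) ^+ b * w) (fun _ _ => isT) op).
  apply: eq_littleo (littleoN (littleoD op' (oq b))) => w bw.
  have := ghE _ (curve_pt k (ltW bw)); rewrite pt0 pt1 add0r => gh.
  rewrite !hornerE exprS.
  have -> : g w = w * ((-1) ^+ b * w ^+ k) - h ((-1) ^+ b * w ^+ k).
    by rewrite gh addrK.
  by rewrite /=; ring.
(* The same sum of coefficients of [p] and [q] would equal both 1 and -1. *)
have := S0 false; have := S0 true.
rewrite !coefB !coefD !coefZ coefXn eqxx q01 expr0 expr1 !mulr1; lra.
Qed.

Theorem mainTheorem1 (R : realType) (k : nat) :
  exists K : set 'rV[R]_2,
    (forall r : nat, (r <= k)%N -> differentiably_basic r K) /\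
    (forall r : nat, (k < r)%N -> ~ differentiably_basic r K).
Proof.
by exists (curve k); split=> r; [apply: curve_basic | apply: curve_not_basic].
Qed.
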